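(* Let $1\le p<\infty$, let $(X,\rho)$ be a semi-normed space, let $f:[a,b]\to X$ be a function, let $\{A_n\}$ be an ascending sequence of (arbitrary) subsets of $[a,b]$ (i.e. $A_n\subseteq A_{n+1}$ for all $n$), and set $A=\bigcup_n A_n$. Then $$\mu^p_\rho(f,A)=\lim_{n\to\infty}\mu^p_\rho(f,A_n)$$ (as an identity in $[0,\infty]$). In particular, if $\{\mu^p_\rho(f,A_n)\}$ is bounded above, then $f\in\mathcal{U}^p_\rho(A;X)$.
   Context: $[a,b]$ is a compact interval and $(X,\rho)$ is a real vector space with a semi-norm $\rho$. A gauge on $[a,b]$ is a function $\delta:[a,b]\to(0,\infty)$. A tagged partition of $[a,b]$ is a finite collection $D=\{([u_i,v_i],t_i):1\le i\le n\}$ of non-overlapping non-degenerate closed intervals with union $[a,b]$ and tags $t_i\in[u_i,v_i]$; it is $\delta$-fine if $[u_i,v_i]\subseteq(t_i-\delta(t_i),t_i+\delta(t_i))$ for every $i$. For such $D$, $(D)\sum\varphi(t)(v-u)$ denotes $\sum_{i=1}^n\varphi(t_i)(v_i-u_i)$. For $f:[a,b]\to X$, $E\subseteq[a,b]$ and $1\le p<\infty$, $$\mu^p_\rho(f,E)=\inf_{\text{gauge }\delta}\ \sup\Big\{(D)\sum 1_E(t)\,\rho(f(t))^p\,(v-u): D\text{ is a }\delta\text{-fine tagged partition of }[a,b]\Big\}\in[0,\infty],$$ where $1_E$ is the indicator function of $E$. The space $\mathcal{U}^p_\rho(E;X)$ consists of all $f$ with $\mu^p_\rho(f,E)<\infty$.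 *)

(* Defs.v *)
From HB Require Import structures.
From mathcomp Require Import all_boot all_order all_algebra.
From mathcomp Require Import all_classical all_reals all_analysis.
Set Implicit Arguments.
Unset Strict Implicit.
Unset Printing Implicit Defensive.
Import Order.TTheory GRing.Theory Num.Theory.
Import numFieldNormedType.Exports.
Local Open Scope classical_set_scope.
Local Open Scope ring_scope.

(* [semiNormedZmodType] is homogeneous only for integer scalars, hence this
   definition over an [lmodType]. *)
Definition seminorm (R : realType) (X : lmodType R) (rho : X -> R) : Prop :=
  [/\ forall x, 0 <= rho x,
      forall (c : R) x, rho (c *: x) = `|c| * rho x
    & forall x y, rho (x + y) <= rho x + rho y].

(* Functions on [a, b] are represented by total functions on R whose values
   outside [a, b] are irrelevant. *)
Definition gauge (R : realType) (a b : R) (delta : R -> R) : Prop :=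
  forall t, t \in `[a, b] -> 0 < delta t.

(* A pair ([u, v], t) is encoded as (u, v, t). *)
Definition tagged_interval (R : realType) : Type := (R * R * R)%type.

Section tagged_interval.
Variable R : realType.
Implicit Type I : tagged_interval R.

Definition lend I : R := I.1.1.
Definition rend I : R := I.1.2.
Definition itag I : R := I.2.

End tagged_interval.

(* A finite collection is a duplicate-free list. *)
Definition tagged_partition (R : realType) (a b : R)
    (D : seq (tagged_interval R)) : Prop :=
  [/\ uniq D,
      forall I, I \in D -> lend I < rend I /\ itag I \in `[lend I, rend I],
      forall I J, I \in D -> J \in D -> I != J ->
        `]lend I, rend I[ `&` `]lend J, rend J[ = set0
    & \bigcup_(I in [set` D]) `[lend I, rend I]%classic = `[a, b]%classic].

Definition fine_partition (R : realType) (delta : R -> R)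
    (D : seq (tagged_interval R)) : Prop :=
  forall I, I \in D ->
    `[lend I, rend I] `<=`
    `]itag I - delta (itag I), itag I + delta (itag I)[.

Definition riemann_sum (R : realType) (D : seq (tagged_interval R))
    (phi : R -> R) : R :=
  \sum_(I <- D) phi (itag I) * (rend I - lend I).

Definition gauge_mu (R : realType) (X : lmodType R) (a b p : R) (rho : X -> R)
    (f : R -> X) (E : set R) : \bar R :=
  ereal_inf [set
    ereal_sup [set (riemann_sum D (fun t => \1_E t * rho (f t) `^ p))%:E
              | D in [set D | tagged_partition a b D /\ fine_partition delta D]]
  | delta in gauge a b].

Definition Uspace (R : realType) (X : lmodType R) (a b p : R) (rho : X -> R)
    (E : set R) : set (R -> X) :=
  [set f | (gauge_mu a b p rho f E < +oo)%E].

(* Main.v *)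
(** Perron's major functions replace sums over partitions: if the fine sums of
    [phi] are bounded by [c], the supremum [H x] of the fine sums over [a, x]
    satisfies [phi t * (v - u) <= H v - H u] for every fine [([u, v], t)], and
    [H b - H a <= c]; conversely such an [H] bounds all fine sums, by
    telescoping.  For an increasing sequence [phi n], choose a major function
    [H n] of increment at most [mu (phi n) + e / 2^(n+1)], and let the gauge at
    [t] be that of [H (k t)], where [k t] is an index at which the limit
    function is attained.  A fine sum is then at most the sum over its cells of
    the increments of [H (k t)].  Patching [H n] and [H n.+1] cell by cell
    yields again a major function of [phi n], of increment at least
    [mu (phi n)], so changing the index from cell to cell costs at most [e] in
    total. *)
Require Import Defs.
From HB Require Import structures.
From mathcomp Require Import all_boot all_order all_algebra.
From mathcomp Require Import all_classical all_reals all_analysis.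
From mathcomp Require Import lra.
Import Order.TTheory GRing.Theory Num.Theory.
Import numFieldNormedType.Exports.
Local Open Scope classical_set_scope.
Local Open Scope ring_scope.

Set Implicit Arguments.
Unset Strict Implicit.

(** Provides radii so small that no member of a finite set other than [x] itself is met; the set
    will consist of cell endpoints. *)
Lemma seq_isolated (R : realType) (x : R) (s : seq R) :
  exists2 e : R, 0 < e & forall y, y \in s -> y != x -> e <= `|y - x|.
Proof.
elim: s => [|z s [e e0 he]]; first by exists 1.
have [->|zx] := eqVneq z x.
  by exists e => // y; rewrite inE => /orP[/eqP->|/he//]; rewrite eqxx.
exists (Num.min e `|z - x|); first by rewrite lt_min e0 normr_gt0 subr_eq0.
move=> y; rewrite inE ge_min => /orP[/eqP->|ys yx]; first by rewrite lexx orbT.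
by rewrite he.
Qed.

(** * Telescoping of increments over a tagged partition *)

Section telescoping.
Variables (R : realType).
Implicit Types (a b : R) (D : seq (tagged_interval R)).

Lemma tagged_partition_cell a b D I : tagged_partition a b D -> I \in D ->
  [/\ a <= lend I, lend I < rend I, rend I <= b & lend I <= itag I <= rend I].
Proof.
move=> [_ cellD _ covD] ID; have [lr] := cellD _ ID.
rewrite in_itv /= => tI.
have mem x : lend I <= x <= rend I -> a <= x <= b.
  move=> xI; have : (\bigcup_(I in [set` D]) `[lend I, rend I]%classic) x.
    by exists I => //=; rewrite in_itv.
  by rewrite covD /= in_itv.
have /andP[? _] := mem (lend I) ltac:(by rewrite lexx ltW).
have /andP[_ ?] := mem (rend I) ltac:(by rewrite lexx ltW).
by [].
Qed.

(* Half-open cells make the covering exact, so that removing the leftmost cell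
   leaves a covering of the same shape. *)
Lemma sum_halfopen_cover (G : R -> R) n : forall a b D, size D = n -> a <= b ->
  uniq D -> (forall I, I \in D -> lend I < rend I) ->
  (forall I J x, I \in D -> J \in D -> lend I <= x < rend I ->
     lend J <= x < rend J -> I = J) ->
  (forall x, a <= x < b <-> exists2 I, I \in D & lend I <= x < rend I) ->
  \sum_(I <- D) (G (rend I) - G (lend I)) = G b - G a.
Proof.
elim: n => [|n IHn] a b D sD ab uD ltD disjD covD.
  have D0 : D = [::] by apply: size0nil.
  rewrite D0 big_nil; have [->|aNb] := eqVneq a b; first by rewrite subrr.
  have [|I] := (covD a).1 _; last by rewrite D0.
  by rewrite lexx lt_neqAle aNb.
have lD I : I \in D -> a <= lend I < b.
  by move=> ID; apply/covD; exists I => //; rewrite lexx ltD.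
have ab' : a < b.
  case: D sD {uD ltD disjD covD} lD => // I D _ /(_ I (mem_head _ _)).
  by case/andP; apply: le_lt_trans.
have [|I ID /andP[lIa aI]] := (covD a).1 _; first by rewrite lexx.
have lI : lend I = a by have /andP[? _] := lD _ ID; apply/le_anti/andP.
have rI : rend I <= b.
  rewrite leNgt; apply/negP => br.
  suff : a <= b < b by rewrite ltxx andbF.
  by apply/covD; exists I => //; rewrite lI ab.
rewrite (big_rem I) //= lI (IHn (rend I) b).
- by rewrite addrC subrKA.
- by rewrite size_rem // sD.
- exact: rI.
- exact: rem_uniq.
- by move=> J /mem_rem/ltD.
- by move=> J K x /mem_rem JD /mem_rem; apply: disjD.
move=> x; split=> [/andP[Ix xb]|[J]].
  have [|J JD xJ] := (covD x).1 _; first by rewrite xb (le_trans (ltW aI)).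
  exists J => //; rewrite mem_rem_uniq // inE JD andbT.
  by apply: contraTneq xJ => ->; rewrite (ltNge x) Ix andbF.
rewrite mem_rem_uniq // inE => /andP[JI JD] xJ.
have /andP[ax ->] : a <= x < b by apply/covD; exists J.
rewrite andbT leNgt; apply: contraNN JI => xI; apply/eqP.
by apply: (disjD _ _ x) => //; rewrite lI ax.
Qed.

Lemma sum_tagged_partition (G : R -> R) a b D : a <= b ->
  tagged_partition a b D ->
  \sum_(I <- D) (G (rend I) - G (lend I)) = G b - G a.
Proof.
move=> ab tpD; have [uD _ disjD covD] := tpD.
have ltD I : I \in D -> lend I < rend I by case/(tagged_partition_cell tpD).
apply: (@sum_halfopen_cover G (size D)) => //.
  move=> I J x ID JD /andP[Ix xI] /andP[Jx xJ].
  (* Otherwise both open cells contain the midpoint of [x] and the smaller right end. *)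
  apply/eqP/negP => /negP IJ; have /seteqP[+ _] := disjD _ _ ID JD IJ.
  set m := Num.min (rend I) (rend J).
  have xm : x < m by rewrite lt_min xI.
  have [h1 h2] := midf_lt xm.
  move/(_ ((x + m) / 2)); apply; split => /=; rewrite in_itv /=.
    by rewrite (le_lt_trans Ix h1) (lt_le_trans h2) ?ge_min ?lexx.
  by rewrite (le_lt_trans Jx h1) (lt_le_trans h2) ?ge_min ?lexx ?orbT.
move=> x; split=> [/andP[ax xb]|[I ID /andP[lx xr]]]; last first.
  have [al _ rb _] := tagged_partition_cell tpD ID.
  by rewrite (le_trans al) ?(lt_le_trans xr).
(* The covering by closed cells is tested at a point [y > x] so close to [x] that no left end lies
   in ]x, y]; the cell of [y] then contains [x] and ends strictly after it. *)
have [e e0 he] := seq_isolated x [seq lend J | J <- D].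
pose y := x + Num.min e (b - x) / 2.
have m0 : 0 < Num.min e (b - x) by rewrite lt_min e0 subr_gt0.
have me : Num.min e (b - x) <= e by rewrite ge_min lexx.
have mb : Num.min e (b - x) <= b - x by rewrite ge_min lexx orbT.
have : `[a, b]%classic y by rewrite /= in_itv /= /y; apply/andP; split; lra.
rewrite -covD => -[I /= ID]; rewrite in_itv /= => /andP[ly yr].
exists I => //; rewrite (lt_le_trans _ yr) ?andbT; last by rewrite /y; lra.
rewrite leNgt; apply/negP => xl.
have := he _ (map_f _ ID) (negbT (gt_eqF xl)).
by rewrite gtr0_norm ?subr_gt0 // => ?; move: ly; rewrite /y; lra.
Qed.

End telescoping.

(** * Upper gauge integrals and Perron major functions *)

Section upper_integral.
Variables (R : realType) (a b : R).
Hypothesis hab : a < b.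
Implicit Types (delta phi H : R -> R) (D : seq (tagged_interval R)).

(** The upper Henstock-Kurzweil integral, of which [gauge_mu] is an instance by conversion. *)
Definition upper_integral phi : \bar R :=
  ereal_inf [set
    ereal_sup [set (riemann_sum D phi)%:E
              | D in [set D | tagged_partition a b D /\ fine_partition delta D]]
  | delta in gauge a b].

Definition major delta phi H := forall u v t, a <= u -> u < v -> v <= b ->
  u <= t <= v -> t - delta t < u -> v < t + delta t ->
  phi t * (v - u) <= H v - H u.

Lemma major_sub delta delta' phi phi' H :
  (forall t, delta' t <= delta t) -> (forall t, phi' t <= phi t) ->
  major delta phi H -> major delta' phi' H.
Proof.
move=> led lep mH u v t au uv vb tuv tu vt.
have := led t => ledt.
apply: le_trans (mH u v t au uv vb tuv _ _); [|lra|lra].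
by rewrite ler_pM2r ?subr_gt0.
Qed.

Lemma fine_partitionP {delta D I} : fine_partition delta D -> I \in D ->
  lend I < rend I ->
  itag I - delta (itag I) < lend I /\ rend I < itag I + delta (itag I).
Proof.
move=> fD ID lr; split.
  have := fD _ ID (lend I); rewrite /= !in_itv /= lexx ltW //.
  by move=> /(_ isT)/andP[].
have := fD _ ID (rend I); rewrite /= !in_itv /= lexx ltW //.
by move=> /(_ isT)/andP[].
Qed.

Lemma upper_integral_le delta phi (c : R) : gauge a b delta ->
  (forall D, tagged_partition a b D -> fine_partition delta D ->
     riemann_sum D phi <= c) ->
  (upper_integral phi <= c%:E)%E.
Proof.
move=> gd hc; apply: ge_ereal_inf; eexists; first by exists delta.
by apply: ge_ereal_sup => _ [D [tpD fD] <-]; rewrite lee_fin hc.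
Qed.

Lemma upper_integral_le_major delta phi H : gauge a b delta ->
  major delta phi H -> (upper_integral phi <= (H b - H a)%:E)%E.
Proof.
move=> gd mH; apply: (upper_integral_le gd) => D tpD fD.
rewrite -(sum_tagged_partition H (ltW hab) tpD) /riemann_sum.
rewrite big_seq [leRHS]big_seq; apply: ler_sum => I ID.
have [al lr rb tI] := tagged_partition_cell tpD ID.
by have [? ?] := fine_partitionP fD ID lr; apply: mH.
Qed.

(** Cells are appended on the right, so that a fine sum over [a, u] extends to [a, v] by a
    constructor. The base case gives the sum 0 to the degenerate interval [a, a], which has no
    tagged partition. *)
Inductive fine_sum delta phi : R -> R -> Prop :=
| fine_sum0 : fine_sum delta phi a 0
| fine_sumS u s v t : fine_sum delta phi u s -> u < v -> u <= t <= v ->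
    t - delta t < u -> v < t + delta t ->
    fine_sum delta phi v (s + phi t * (v - u)).

Lemma fine_sum_partition delta phi x s : fine_sum delta phi x s ->
  (x = a /\ s = 0) \/ (a < x /\ exists D, [/\ tagged_partition a x D,
     fine_partition delta D & riemann_sum D phi = s]).
Proof.
elim=> {x s} [|u s v t _ IH uv tuv tu vt]; first by left.
right; pose J : tagged_interval R := (u, v, t).
have fJ : `[lend J, rend J]%classic `<=`
    `]itag J - delta (itag J), itag J + delta (itag J)[%classic.
  move=> y /=; rewrite !in_itv /= /J /lend /rend /itag /= => /andP[? ?].
  by apply/andP; split; lra.
case: IH => [[ua ->]|[au [D [tpD fD sD]]]].
  split; first by rewrite -ua.
  exists [:: J]; split.
  - split=> //.
    + by move=> I; rewrite inE => /eqP->; rewrite in_itv.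
    + by move=> I K; rewrite !inE => /eqP-> /eqP->; rewrite eqxx.
    + apply/seteqP; split=> [y [I /=]|y /= yab].
        by rewrite inE => /eqP->; rewrite -ua.
      by exists J; rewrite /= ?inE ?eqxx // /J /lend /rend /= ua.
  - by move=> I; rewrite inE => /eqP->.
  - by rewrite /riemann_sum big_seq1 add0r.
split; first exact: lt_trans uv.
have cD I : I \in D -> rend I <= u.
  by case/(tagged_partition_cell tpD).
have JD : J \notin D by apply/negP => /cD; rewrite /J /rend /= leNgt uv.
have disjJ I : I \in D -> `]lend I, rend I[ `&` `]u, v[ = set0.
  move=> /cD rI; apply/seteqP; split=> // y [] /=; rewrite !in_itv /=.
  by move=> /andP[_ ?] /andP[? _]; lra.
have [uD cellD dD covD] := tpD.
exists (J :: D); split.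
- split; first by rewrite /= JD.
  + move=> I; rewrite inE => /orP[/eqP->|/cellD//]; by rewrite in_itv.
  + move=> I K; rewrite !inE => /orP[/eqP->|ID] /orP[/eqP->|KD].
    * by rewrite eqxx.
    * by move=> _; rewrite setIC; apply: disjJ.
    * by move=> _; apply: disjJ.
    * exact: dD.
  + apply/seteqP; split=> [y [I /=]|y /=].
      rewrite inE => /orP[/eqP->|ID].
        rewrite !in_itv /= /J /lend /rend /= => /andP[? ?].
        by apply/andP; split; lra.
      have [? _ ? _] := tagged_partition_cell tpD ID.
      by rewrite !in_itv /= => /andP[? ?]; apply/andP; split; lra.
    rewrite in_itv /= => /andP[ay yv]; have [yu|uy] := leP y u.
      have : `[a, u]%classic y by rewrite /= in_itv /= ay.
      rewrite -covD => -[I /= ID yI]; exists I => //=.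
      by rewrite inE ID orbT.
    exists J; first by rewrite /= inE eqxx.
    by rewrite /= in_itv /= /J /lend /rend /= (ltW uy).
- by move=> I; rewrite inE => /orP[/eqP->//|/fD].
- by rewrite /riemann_sum big_cons /= -sD addrC.
Qed.

(* Cousin's lemma, by the supremum of the points that can be reached. *)
Lemma fine_sum_extend delta phi x s y : gauge a b delta ->
  (forall t, 0 <= phi t) -> fine_sum delta phi x s -> a <= x -> x <= y ->
  y <= b -> exists2 s', s <= s' & fine_sum delta phi y s'.
Proof.
move=> gd phi0 xs ax xy yb.
pose S := [set z | x <= z <= y /\ exists2 s', s <= s' & fine_sum delta phi z s'].
have Sx : S x by split; [rewrite lexx|exists s].
have hS : has_sup S by split; [exists x|exists y => z [/andP[]]].
pose c := sup S.
have xc : x <= c by apply: ub_le_sup => //; case: hS.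
have cy : c <= y by apply: ge_sup; [exists x|move=> z [/andP[]]].
have dc : 0 < delta c by apply: gd; rewrite in_itv /=; apply/andP; split; lra.
have [z Sz cz] := sup_adherent dc hS.
have zc : z <= c by apply: ub_le_sup => //; case: hS.
have {}cz : c - delta c < z by [].
have [/andP[xz zy] [s1 ss1 zs1]] := Sz.
(* A single cell tagged [c], with left end [z], reaches beyond [c]. *)
have reach w : c <= w -> w < c + delta c ->
    exists2 s', s <= s' & fine_sum delta phi w s'.
  move=> cw wd; have [zw|zw] := ltP z w.
    exists (s1 + phi c * (w - z)).
      by rewrite (le_trans ss1) // lerDl mulr_ge0 // subr_ge0 ltW.
    by apply: fine_sumS => //; rewrite zc.
  have -> : w = z by lra.
  by exists s1.
have [yc|cy'] := leP y (c + delta c / 2); first by apply: reach => //; lra.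
(* Here [c + delta c / 2] would be a reachable point above the supremum. *)
suff : c + delta c / 2 <= c by lra.
apply: ub_le_sup; first by case: hS.
split; first by apply/andP; split; lra.
by apply: reach; lra.
Qed.

(** Nonnegative terms alone do not suffice, the supremum of the empty set being -oo: Cousin's lemma
    supplies a fine partition for every gauge. *)
Lemma upper_integral_ge0 phi : (forall t, 0 <= phi t) ->
  (0 <= upper_integral phi)%E.
Proof.
move=> phi0; apply: le_ereal_inf_tmp => _ [delta gd <-].
have [s s0 bs] := fine_sum_extend gd phi0 (fine_sum0 delta phi)
  (lexx a) (ltW hab) (lexx b).
case: (fine_sum_partition bs) => [[ba _]|[_ [D [tpD fD sD]]]].
  by move: hab; rewrite ba ltxx.
by apply: le_ereal_sup_tmp; exists s%:E; [exists D => //; rewrite sD|].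
Qed.

Lemma upper_integral_major phi (c : R) : (forall t, 0 <= phi t) ->
  (upper_integral phi < c%:E)%E ->
  exists delta H, [/\ gauge a b delta, major delta phi H & H b - H a <= c].
Proof.
move=> phi0 /ereal_inf_lt[_ [delta gd <-] supc].
have bsum s : fine_sum delta phi b s -> s <= c.
  case/fine_sum_partition => [[ba _]|[_ [D [tpD fD sD]]]].
    by move: hab; rewrite ba ltxx.
  rewrite -lee_fin; apply: le_trans (ltW supc).
  by apply: ereal_sup_ubound; exists D => //; rewrite sD.
pose H x := sup [set s | fine_sum delta phi x s].
have hH x : a <= x <= b -> has_sup [set s | fine_sum delta phi x s].
  move=> /andP[ax xb]; split.
    have [s _ xs] := fine_sum_extend gd phi0 (fine_sum0 delta phi)
      (lexx a) ax xb.
    by exists s.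
  (* Since [phi] is nonnegative, each fine sum over [a, x] grows to one over [a, b], which [c]
     bounds. *)
  exists c => s /= xs.
  have [s' ss' bs'] := fine_sum_extend gd phi0 xs ax xb (lexx b).
  exact: le_trans (bsum _ bs').
exists delta, H; split => //.
  move=> u v t au uv vb tuv tu vt.
  rewrite lerBrDr addrC -lerBrDr; apply: ge_sup.
    by have [] := hH u ltac:(by rewrite au; lra).
  move=> s /= us; rewrite lerBrDr; apply: ub_le_sup.
    by have [] := hH v ltac:(by rewrite vb andbT; lra).
  exact: fine_sumS.
have Ha : 0 <= H a.
  apply: ub_le_sup; last exact: fine_sum0.
  by have [] := hH a ltac:(by rewrite lexx ltW).
have Hb : H b <= c.
  by apply: ge_sup => //; have [] := hH b ltac:(by rewrite lexx ltW).
lra.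
Qed.

(** * Patching major functions cell by cell *)

Definition clamp (l r x : R) := Num.min (Num.max x l) r.

(** Both sides are the length of the overlap of [l, r] and [u, v]. *)
Lemma clampB (l r u v : R) : l <= r -> u <= v ->
  clamp l r v - clamp l r u = clamp u v r - clamp u v l.
Proof.
move=> lr uv; rewrite /clamp.
case: (leP v l) => ?; case: (leP u l) => ?; case: (leP r u) => ?;
  case: (leP l u) => ?; do ?case: leP => ?; lra.
Qed.

(* Running through the function chosen for each cell yields a major function
   as soon as the gauge forces every endpoint met by a fine interval to be its
   tag. *)
Lemma upper_integral_le_mix delta phi D (F : tagged_interval R -> R -> R) :
  gauge a b delta -> tagged_partition a b D ->
  (forall I, I \in D -> major delta phi (F I)) ->
  (upper_integral phi <= (\sum_(I <- D) (F I (rend I) - F I (lend I)))%:E)%E.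
Proof.
move=> gd tpD mF.
have /choice[e he] : forall t, exists e, 0 < e /\ forall y,
    y \in [seq lend J | J <- D] ++ [seq rend J | J <- D] ->
    y != t -> e <= `|y - t|.
  move=> t; have [e] := seq_isolated t
    ([seq lend J | J <- D] ++ [seq rend J | J <- D]).
  by exists e.
(* Each [F I] contributes only while [x] crosses the cell [I], the clamped argument being constant
   elsewhere. *)
pose K x := \sum_(I <- D) F I (clamp (lend I) (rend I) x).
pose delta' t := Num.min (delta t) (e t).
have -> : \sum_(I <- D) (F I (rend I) - F I (lend I)) = K b - K a.
  rewrite /K -sumrB !big_seq; apply: eq_bigr => I ID.
  have [al lr rb _] := tagged_partition_cell tpD ID.
  rewrite /clamp (max_l (le_trans (ltW lr) rb)) (min_r rb).
  by rewrite (max_r al) (min_l (ltW lr)).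
apply: (@upper_integral_le_major delta').
  by move=> t tab; rewrite lt_min gd //=; case: (he t).
move=> u v t au uv vb /andP[ut tv] tu vt.
have d1 : delta' t <= delta t by rewrite ge_min lexx.
have d2 : delta' t <= e t by rewrite ge_min lexx orbT.
have out y : y \in [seq lend J | J <- D] ++ [seq rend J | J <- D] ->
    u <= y <= v -> y = t.
  move=> yD /andP[uy yv]; apply/eqP/negPn/negP => yt.
  have := (he t).2 y yD yt; apply/negP; rewrite -ltNge ltr_norml.
  by apply/andP; split; lra.
(* The length of [u, v] is distributed over the cells that it overlaps. *)
have -> : v - u = \sum_(I <- D) (clamp u v (rend I) - clamp u v (lend I)).
  rewrite (sum_tagged_partition (clamp u v) (ltW hab) tpD) /clamp.
  rewrite (max_l (le_trans (ltW uv) vb)) (min_r vb).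
  by rewrite (max_r au) (min_l (ltW uv)).
rewrite /K -sumrB mulr_sumr !big_seq; apply: ler_sum => I ID.
have [al lr rb _] := tagged_partition_cell tpD ID.
rewrite -(clampB (ltW lr) (ltW uv)).
have lo : u <= lend I <= v -> lend I = t.
  by apply: out; rewrite mem_cat map_f.
have ro : u <= rend I <= v -> rend I = t.
  by apply: out; rewrite mem_cat map_f ?orbT.
rewrite /clamp.
have [vl|lv] := leP v (lend I).
  by rewrite max_r ?subrr ?mulr0 // (le_trans (ltW uv)).
have [ru|ur] := leP (rend I) u.
  rewrite (max_l (le_trans (ltW lr) ru)) !min_r ?subrr ?mulr0 //.
  by rewrite (le_trans ru (ltW uv)).
(* Each end of the overlap [u', v'] is either the corresponding end of [u, v] or a cell endpoint met
   by [u, v], which equals [t]. So [t] lies in the overlap and the major inequality of [F I] applies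
   there. *)
set u' := Num.min (Num.max u _) _; set v' := Num.min v _.
have [u'1 u'2] : u' = Num.max u (lend I) /\ v' = Num.min v (rend I).
  by split=> //; apply: min_l; rewrite ge_max (ltW ur) ltW.
have ru' : u' = u \/ u' = lend I /\ u <= lend I.
  by rewrite u'1; case: leP => ?; [right|left].
have rv' : v' = v \/ v' = rend I /\ rend I <= v.
  rewrite u'2; have [vr|/ltW rv] := leP v (rend I); [by left|by right].
have uu' : u <= u' by case: ru' => [->|[->]].
have vv' : v' <= v by case: rv' => [->|[->]].
have u'v' : u' < v'.
  by case: ru' => [->|[-> _]]; case: rv' => [->|[-> _]].
apply: (mF I ID) => //; lra.
Qed.

Lemma le_upper_integral phi psi : (forall t, phi t <= psi t) ->
  (upper_integral phi <= upper_integral psi)%E.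
Proof.
move=> le; apply: le_ereal_inf_tmp => _ [delta gd <-].
apply: ge_ereal_inf; eexists; first by exists delta.
apply: ge_ereal_sup => _ [D [tpD fD] <-].
apply: le_ereal_sup_tmp; exists (riemann_sum D psi)%:E; first by exists D.
rewrite lee_fin /riemann_sum !big_seq; apply: ler_sum => I ID.
have [_ lr _ _] := tagged_partition_cell tpD ID.
by rewrite ler_pM2r ?subr_gt0.
Qed.

(** * Monotone limits of upper integrals *)

Section monotone_limit.
Variables (phi : nat -> R -> R) (m : nat -> R) (e : R).
Variables (delta H : nat -> R -> R).
Hypothesis phi_nd : forall n t, phi n t <= phi n.+1 t.
Hypothesis gdelta : forall n, gauge a b (delta n).
Hypothesis majorH : forall n, major (delta n) (phi n) (H n).
Hypothesis phi_m : forall n, upper_integral (phi n) = (m n)%:E.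
Hypothesis H_m : forall n, H n b - H n a <= m n + e * 2^-1 ^+ n.+1.

(* In the inductive step the cells that use [H N.+1] are exchanged with those
   that do not: [H N.+1] on the latter and [H N] on the former mix to at least
   [m N], which compensates the bound [m N] of the induction hypothesis. *)
Lemma major_selection_le N D (k : tagged_interval R -> nat) :
  tagged_partition a b D -> (forall I, I \in D -> (k I <= N)%N) ->
  \sum_(I <- D) (H (k I) (rend I) - H (k I) (lend I)) <=
  m N + e * (1 - 2^-1 ^+ N.+1).
Proof.
move=> tpD; have tele n := sum_tagged_partition (H n) (ltW hab) tpD.
elim: N k => [|N IHN] k kN.
  have -> : \sum_(I <- D) (H (k I) (rend I) - H (k I) (lend I)) = H 0 b - H 0 a.
    rewrite -tele !big_seq; apply: eq_bigr => I /kN.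
    by rewrite leqn0 => /eqP->.
  by apply: le_trans (H_m 0) _; rewrite expr1 lerD2l; lra.
pose F I := if (k I <= N)%N then H N.+1 else H N.
have mixF : m N <= \sum_(I <- D) (F I (rend I) - F I (lend I)).
  pose d t := Num.min (delta N t) (delta N.+1 t).
  rewrite -lee_fin -phi_m; apply: (@upper_integral_le_mix d) => //.
    by move=> t tab; rewrite lt_min !gdelta.
  move=> I _; rewrite /F; case: ifP => _.
    apply: major_sub (phi_nd N) (@majorH N.+1) => t.
    by rewrite ge_min lexx orbT.
  by apply: major_sub (@majorH N) => t //; rewrite ge_min lexx.
have := IHN (fun I => minn (k I) N) (fun I _ => geq_minr _ _).
(* On every cell, the selection and [F] together use the same two functions as the selection capped
   at [N] and [H N.+1]. *)
have -> : \sum_(I <- D) (H (k I) (rend I) - H (k I) (lend I)) =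
    \sum_(I <- D) (H (minn (k I) N) (rend I) - H (minn (k I) N) (lend I)) +
    (H N.+1 b - H N.+1 a) - \sum_(I <- D) (F I (rend I) - F I (lend I)).
  rewrite -tele -big_split -sumrB /= !big_seq; apply: eq_bigr => I ID.
  rewrite /F; case: leqP => [kIN|NkI]; first by lra.
  have -> : k I = N.+1 by apply/eqP; rewrite eqn_leq kN.
  lra.
(* The errors combine as 1 - 2^-(N+1) + 2^-(N+2) = 1 - 2^-(N+2). *)
have := H_m N.+1; rewrite [2^-1 ^+ N.+2]exprS; set x := 2^-1 ^+ N.+1.
move=> h1 h2; lra.
Qed.

End monotone_limit.

Lemma upper_integral_le_sup (phi : nat -> R -> R) psi :
  (forall n t, 0 <= phi n t) -> (forall n t, phi n t <= phi n.+1 t) ->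
  (forall t, exists n, psi t <= phi n t) ->
  (upper_integral psi <= ereal_sup (range (fun n => upper_integral (phi n))))%E.
Proof.
move=> phi0 phi_nd psi_phi; set M := ereal_sup _.
have leM n : (upper_integral (phi n) <= M)%E.
  by apply: ereal_sup_ubound; exists n.
have [->|Mfin] := eqVneq M +oo%E; first exact: leey.
have fin n : upper_integral (phi n) \is a fin_num.
  rewrite ge0_fin_numE ?upper_integral_ge0 //.
  by rewrite (le_lt_trans (leM n)) // ltey.
pose m n := fine (upper_integral (phi n)).
have phi_m n : upper_integral (phi n) = (m n)%:E by rewrite fineK.
apply/lee_addgt0Pr => e e0.
have /choice[dH hdH] n : exists dH : (R -> R) * (R -> R),
    [/\ gauge a b dH.1, major dH.1 (phi n) dH.2 &
        dH.2 b - dH.2 a <= m n + e * 2^-1 ^+ n.+1].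
  have [//||d [H ?]] := @upper_integral_major (phi n) (m n + e * 2^-1 ^+ n.+1).
    by rewrite phi_m lte_fin ltrDl mulr_gt0 // exprn_gt0.
  by exists (d, H).
have [k hk] := choice psi_phi.
(* The largest index met depends on the partition, hence the comparison with the supremum of all
   [m n + e]. *)
apply: (@le_trans _ _ (ereal_sup [set (m n + e)%:E | n in setT])); last first.
  apply: ge_ereal_sup => _ [n _ <-].
  by rewrite EFinD -phi_m leeD2r.
apply: ge_ereal_inf; eexists; first exists (fun t => (dH (k t)).1 t) => //.
  by move=> t tab; have [gd _ _] := hdH (k t); apply: gd.
apply: ge_ereal_sup => _ [D [tpD fD] <-].
pose N := \max_(I <- D) k (itag I).
apply: le_ereal_sup_tmp; exists (m N + e)%:E; first by exists N.
rewrite lee_fin.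
apply: (@le_trans _ _ (m N + e * (1 - 2^-1 ^+ N.+1))); last first.
  rewrite lerD2l; have : 0 <= 2^-1 ^+ N.+1 :> R by apply: exprn_ge0.
  by nra.
pose H n := (dH n).2.
apply: le_trans (@major_selection_le phi m e (fun n => (dH n).1) H _ _ _ _ _ N D
  (k \o @itag R) tpD _) => //; try by move=> n; case: (hdH n).
  (* Each cell is fine for the gauge of the index [k (itag I)] of its own tag, whose major function
     bounds the term. *)
  rewrite /riemann_sum !big_seq; apply: ler_sum => I ID /=.
  have [al lr rb tI] := tagged_partition_cell tpD ID.
  have [tl rt] := fine_partitionP fD ID lr.
  have [_ mH _] := hdH (k (itag I)).
  apply: le_trans (mH _ _ _ al lr rb tI tl rt).
  by rewrite ler_pM2r ?subr_gt0.
by move=> I ID; apply: (@leq_bigmax_seq _ D xpredT (fun J => k (itag J)) I).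
Qed.

End upper_integral.

(** * Application to an ascending sequence of sets *)

Unset Implicit Arguments.
Set Strict Implicit.

Theorem theorem6 (R : realType) (X : lmodType R) (rho : X -> R) (a b p : R)
    (f : R -> X) (A : nat -> set R)
    (hrho : seminorm rho) (hab : a < b) (hp : 1 <= p)
    (hAab : forall n, A n `<=` `[a, b])
    (hA : forall n, A n `<=` A n.+1) :
  (gauge_mu a b p rho f (A n) @[n --> \oo]
     --> gauge_mu a b p rho f (\bigcup_n A n)) /\
  ((exists M : R, forall n, (gauge_mu a b p rho f (A n) <= M%:E)%E) ->
     Uspace a b p rho (\bigcup_n A n) f).
Proof.
pose phi (E : set R) t := \1_E t * rho (f t) `^ p.
have muE E : gauge_mu a b p rho f E = upper_integral a b (phi E) by [].
have phi0 E t : 0 <= phi E t by rewrite mulr_ge0 ?powR_ge0.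
have phi_le (E F : set R) t : (E t -> F t) -> phi E t <= phi F t.
  move=> EF; rewrite ler_wpM2r ?powR_ge0 // !indicE ler_nat.
  have [/set_mem/EF/mem_set->//|_] := boolP (t \in E).
  by case: (t \in F).
have musup : gauge_mu a b p rho f (\bigcup_n A n) =
    ereal_sup (range (fun n => gauge_mu a b p rho f (A n))).
  apply/le_anti/andP; split; last first.
    apply: ge_ereal_sup => _ [n _ <-]; rewrite !muE.
    by apply: le_upper_integral => t; apply: phi_le => At; exists n.
  rewrite muE; apply: (@upper_integral_le_sup _ _ _ hab (fun n => phi (A n))).
  - by move=> n t; apply: phi0.
  - by move=> n t; apply/phi_le/hA.
  (* On the union, the limit integrand is attained at some [A n]; off it the integrand vanishes and
     any index serves. *)
  move=> t; have [[n _ At]|nA] := pselect ((\bigcup_n A n) t).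
    by exists n; apply: phi_le.
  by exists 0; apply: phi_le => /nA.
split.
  rewrite musup; apply: ereal_nondecreasing_cvgn.
  apply/nondecreasing_seqP => n; rewrite !muE.
  by apply: le_upper_integral => t; apply/phi_le/hA.
move=> [M hM]; rewrite /Uspace /= musup.
apply: le_lt_trans (ltry M).
by apply: ge_ereal_sup => _ [n _ <-].
Qed.
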